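(* Let $k$ be a nonzero commutative ring, let $V$ be a free $k$-module of countably infinite rank with basis $v_1,v_2,\dots$, and let $R=\mathrm{End}_k(V)$, identified with the ring of column-finite $\mathbb{N}\times\mathbb{N}$ matrices over $k$ with matrix units $e_{i,j}$. Put $x=\sum_{n\ge 1}e_{n,n+1}$ and $y=\sum_{n\ge 1}e_{n+1,n}$ in $R$, and let $S=k1_R+yRx$, a subring of $R$. Then the ring extension $R/S$ is not a Frobenius extension and is not H-separable.
   Context: Here $xy=1$ and $yx\neq 1$, and $S$ is the subalgebra of matrices of block form $\begin{pmatrix} a & 0\\ 0 & D\end{pmatrix}$ with $a\in k$ and $D$ column-finite. A ring extension $R/S$ is Frobenius if $R_S$ is finitely generated projective and $R\cong\mathrm{Hom}(R_S,S_S)$ as $S$-$R$-bimodules, where $(sfr)(x)=s\,f(rx)$. A ring extension $R/S$ is H-separable if $R\otimes_S R$ is isomorphic, as an $R$-bimodule, to a direct summand of $R^n$ for some positive integer $n$. *)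

(* Defs.v *)
From HB Require Import structures.
From mathcomp Require Import all_boot all_algebra.
From mathcomp Require Import boolp functions.
From mathcomp Require Import freeg.

Set Implicit Arguments.
Unset Strict Implicit.
Unset Printing Implicit Defensive.

Import GRing.Theory.
Local Open Scope ring_scope.
Local Open Scope quotient_scope.

Definition linhom (T : pzRingType) (U V : lmodType T) := {linear U -> V}.

Section LinHom.
Variables (T : pzRingType) (U V : lmodType T).

HB.instance Definition _ := gen_eqMixin (linhom U V).
HB.instance Definition _ := gen_choiceMixin (linhom U V).

Lemma linhomP (f g : linhom U V) : f =1 g -> f = g.
Proof.
case: f g => f [[hf0] [hf1]] [g [[hg0] [hg1]]] /= /funext fg.
by subst g; rewrite (Prop_irrelevance hf0 hg0) (Prop_irrelevance hf1 hg1).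
Qed.

Definition lin0 : linhom U V := (\0 : U -> V).
Definition lin_add (f g : linhom U V) : linhom U V := (f \+ g).
Definition lin_opp (f : linhom U V) : linhom U V := (\- f).

Fact lin_addA : associative lin_add.
Proof. by move=> f g h; apply: linhomP => u /=; rewrite addrA. Qed.
Fact lin_addC : commutative lin_add.
Proof. by move=> f g; apply: linhomP => u /=; rewrite addrC. Qed.
Fact lin_add0 : left_id lin0 lin_add.
Proof. by move=> f; apply: linhomP => u /=; rewrite add0r. Qed.
Fact lin_addN : left_inverse lin0 lin_opp lin_add.
Proof. by move=> f; apply: linhomP => u /=; rewrite addNr. Qed.

HB.instance Definition _ :=
  GRing.isZmodule.Build (linhom U V) lin_addA lin_addC lin_add0 lin_addN.

End LinHom.

(* [lend V] is the ring End_k(V), with composition as product. *)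
Definition lend (k : comNzRingType) (V : lmodType k) := linhom V V.

Section LEnd.
Variables (k : comNzRingType) (V : lmodType k).

HB.instance Definition _ := GRing.Zmodule.on (lend V).

Definition lend_one : lend V := (idfun : V -> V).
Definition lend_mul (f g : lend V) : lend V := (f \o g).
Definition lend_scale (a : k) (f : lend V) : lend V := (a \*: f).

Fact lend_mulA : associative lend_mul.
Proof. by move=> f g h; apply: linhomP. Qed.
Fact lend_mul1 : left_id lend_one lend_mul.
Proof. by move=> f; apply: linhomP. Qed.
Fact lend_1mul : right_id lend_one lend_mul.
Proof. by move=> f; apply: linhomP. Qed.
Fact lend_mulDl : left_distributive lend_mul +%R.
Proof. by move=> f g h; apply: linhomP. Qed.
Fact lend_mulDr : right_distributive lend_mul +%R.
Proof. by move=> f g h; apply: linhomP => u /=; rewrite linearD. Qed.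

HB.instance Definition _ := GRing.Zmodule_isPzRing.Build (lend V)
  lend_mulA lend_mul1 lend_1mul lend_mulDl lend_mulDr.

Fact lend_scaleA a b f : lend_scale a (lend_scale b f) = lend_scale (a * b) f.
Proof. by apply: linhomP => u /=; rewrite scalerA. Qed.
Fact lend_scale1 : left_id 1 lend_scale.
Proof. by move=> f; apply: linhomP => u /=; rewrite scale1r. Qed.
Fact lend_scaleDr : right_distributive lend_scale +%R.
Proof. by move=> a f g; apply: linhomP => u /=; rewrite scalerDr. Qed.
Fact lend_scaleDl f : {morph lend_scale^~ f : a b / a + b}.
Proof. by move=> a b; apply: linhomP => u /=; rewrite scalerDl. Qed.

HB.instance Definition _ := GRing.Zmodule_isLmodule.Build k (lend V)
  lend_scaleA lend_scale1 lend_scaleDr lend_scaleDl.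

Lemma lendME (f g : lend V) u : (f * g) u = f (g u). Proof. by []. Qed.
Lemma lend1E u : (1 : lend V) u = u. Proof. by []. Qed.
Lemma lendDE (f g : lend V) u : (f + g) u = f u + g u. Proof. by []. Qed.
Lemma lendZE a (f : lend V) u : (a *: f) u = a *: f u. Proof. by []. Qed.

End LEnd.

(* The sequence is indexed from 0: [v n] is the basis vector v_{n+1}. *)
Definition is_basis (k : comNzRingType) (V : lmodType k) (v : nat -> V) : Prop :=
  (forall n (c : 'I_n -> k),
      \sum_(i < n) c i *: v i = 0 -> forall i, c i = 0) /\
  (forall u, exists n (c : 'I_n -> k), u = \sum_(i < n) c i *: v i).

(* [f] has the column-finite matrix [M] in the basis [v]: the j-th column of
   [M] lists the coordinates of [f (v j)]. *)
Definition has_matrix (k : comNzRingType) (V : lmodType k) (v : nat -> V)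
    (f : lend V) (M : nat -> nat -> k) : Prop :=
  forall j, exists n, (forall i, (n <= i)%N -> M i j = 0) /\
    f (v j) = \sum_(i < n) M i j *: v i.

Lemma corner_subring_closed (k : comNzRingType) (V : lmodType k)
    (x y : lend V) : x * y = 1 ->
  subring_closed [pred z : lend V |
    `[< exists (a : k) (r : lend V), z = a *: (1 : lend V) + y * r * x >]].
Proof.
have scl a (f g : lend V) : a *: (f * g) = (a *: f) * g by apply: linhomP.
have scr a (f g : lend V) : a *: (f * g) = f * (a *: g).
  by apply: linhomP => u; apply: (esym (linearZ_LR f a (g u))).
move=> xy1; split.
- by apply/asboolP; exists 1, 0; rewrite scale1r mulr0 mul0r addr0.
- move=> _ _ /asboolP[a [r ->]] /asboolP[b [s ->]]; apply/asboolP.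
  exists (a - b), (r - s).
  by rewrite scalerBl mulrBr mulrBl opprD addrACA.
- move=> _ _ /asboolP[a [r ->]] /asboolP[b [s ->]]; apply/asboolP.
  exists (a * b), (a *: s + b *: r + r * s).
  have -> : r * s = r * (x * y) * s by rewrite xy1 mulr1.
  rewrite mulrDl !mulrDr -!scl !mul1r -!scr !mulr1 scalerA !mulrDl -!addrA.
  by rewrite -!scl !mulrA.
Qed.

Definition finitely_generated (T : pzRingType) (M : lmodType T) : Prop :=
  exists n (g : 'I_n -> M), forall m, exists c : 'I_n -> T,
    m = \sum_(i < n) c i *: g i.

Definition projective (T : pzRingType) (P : lmodType T) : Prop :=
  forall (M N : lmodType T) (g : {linear M -> N}) (f : {linear P -> N}),
    (forall z, exists m, g m = z) ->
    exists h : {linear P -> M}, forall p, g (h p) = f p.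

Record bimod (A B : pzRingType) := Bimod {
  bimod_sort :> zmodType;
  lact : A -> bimod_sort -> bimod_sort;
  ract : bimod_sort -> B -> bimod_sort;
  lact1 : forall m, lact 1 m = m;
  lactA : forall a a' m, lact (a * a') m = lact a (lact a' m);
  lactDl : forall a a' m, lact (a + a') m = lact a m + lact a' m;
  lactDr : forall a m m', lact a (m + m') = lact a m + lact a m';
  ract1 : forall m, ract m 1 = m;
  ractA : forall m b b', ract m (b * b') = ract (ract m b) b';
  ractDl : forall m m' b, ract (m + m') b = ract m b + ract m' b;
  ractDr : forall m b b', ract m (b + b') = ract m b + ract m b';
  lractA : forall a m b, ract (lact a m) b = lact a (ract m b) }.

Definition bimod_iso A B (M N : bimod A B) : Prop :=
  exists f : {additive M -> N},
    [/\ bijective f, forall a m, f (lact a m) = lact a (f m)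
      & forall m b, f (ract m b) = ract (f m) b].

Definition bimod_reg (A : pzRingType) : bimod A A :=
  @Bimod A A A *%R *%R (@mul1r A) (fun a b c => esym (mulrA a b c))
    (fun a b c => mulrDl a b c) (fun a b c => mulrDr a b c)
    (@mulr1 A) (@mulrA A) (fun a b c => mulrDl a b c)
    (fun a b c => mulrDr a b c) (fun a b c => esym (mulrA a b c)).

Section Restriction.
Variables (A B A' B' : pzRingType).
Variables (f : {rmorphism A' -> A}) (g : {rmorphism B' -> B}) (M : bimod A B).

Program Definition bimod_res : bimod A' B' :=
  @Bimod A' B' M (fun a m => lact (f a) m) (fun m b => ract m (g b))
    _ _ _ _ _ _ _ _ _.
Next Obligation. by rewrite rmorph1 lact1. Qed.
Next Obligation. by rewrite rmorphM lactA. Qed.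
Next Obligation. by rewrite rmorphD lactDl. Qed.
Next Obligation. exact: lactDr. Qed.
Next Obligation. by rewrite rmorph1 ract1. Qed.
Next Obligation. by rewrite rmorphM ractA. Qed.
Next Obligation. exact: ractDl. Qed.
Next Obligation. by rewrite rmorphD ractDr. Qed.
Next Obligation. exact: lractA. Qed.

End Restriction.

Section DirectSums.
Variables (A B : pzRingType).

Program Definition bimod_sum (M N : bimod A B) : bimod A B :=
  @Bimod A B (M * N)%type
    (fun a p => (lact a p.1, lact a p.2)) (fun p b => (ract p.1 b, ract p.2 b))
    _ _ _ _ _ _ _ _ _.
Next Obligation. by rewrite !lact1. Qed.
Next Obligation. by rewrite !lactA. Qed.
Next Obligation. by rewrite !lactDl. Qed.
Next Obligation. by rewrite !lactDr. Qed.
Next Obligation. by rewrite !ract1. Qed.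
Next Obligation. by rewrite !ractA. Qed.
Next Obligation. by rewrite !ractDl. Qed.
Next Obligation. by rewrite !ractDr. Qed.
Next Obligation. by rewrite !lractA. Qed.

Program Definition bimod_pow (M : bimod A B) (n : nat) : bimod A B :=
  @Bimod A B {ffun 'I_n -> M}
    (fun a u => [ffun i => lact a (u i)]) (fun u b => [ffun i => ract (u i) b])
    _ _ _ _ _ _ _ _ _.
Next Obligation. by apply/ffunP => i; rewrite !ffunE lact1. Qed.
Next Obligation. by apply/ffunP => i; rewrite !ffunE lactA. Qed.
Next Obligation. by apply/ffunP => i; rewrite !ffunE lactDl. Qed.
Next Obligation. by apply/ffunP => i; rewrite !ffunE lactDr. Qed.
Next Obligation. by apply/ffunP => i; rewrite !ffunE ract1. Qed.
Next Obligation. by apply/ffunP => i; rewrite !ffunE ractA. Qed.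
Next Obligation. by apply/ffunP => i; rewrite !ffunE ractDl. Qed.
Next Obligation. by apply/ffunP => i; rewrite !ffunE ractDr. Qed.
Next Obligation. by apply/ffunP => i; rewrite !ffunE lractA. Qed.

(* [M] is isomorphic to a direct summand of [N]. *)
Definition iso_summand (M N : bimod A B) : Prop :=
  exists Q : bimod A B, bimod_iso (bimod_sum M Q) N.

End DirectSums.

(* The underlying right module of a bimodule; right [B]-modules are modules
   over the converse ring [B^c], so [b *: m] in [rmod M] is [ract m b]. *)
Definition rmod (A B : pzRingType) (M : bimod A B) : Type := M.

Section RightModule.
Variables (A B : pzRingType) (M : bimod A B).

HB.instance Definition _ := GRing.Zmodule.on (rmod M).

Definition rmod_scale (b : B^c) (m : rmod M) : rmod M := ract (m : M) b.

Fact rmod_scaleA b b' m :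
  rmod_scale b (rmod_scale b' m) = rmod_scale (b * b') m.
Proof. exact: (esym (ractA (m : M) b' b)). Qed.
Fact rmod_scale1 : left_id 1 rmod_scale.
Proof. exact: (@ract1 A B M). Qed.
Fact rmod_scaleDr : right_distributive rmod_scale +%R.
Proof. by move=> b m m'; apply: (@ractDl A B M). Qed.
Fact rmod_scaleDl m : {morph rmod_scale^~ m : b b' / b + b'}.
Proof. by move=> b b'; apply: (@ractDr A B M). Qed.

HB.instance Definition _ := GRing.Zmodule_isLmodule.Build B^c (rmod M)
  rmod_scaleA rmod_scale1 rmod_scaleDr rmod_scaleDl.

End RightModule.

(* For a (C, B)-bimodule [M] and an (A, B)-bimodule [N], [bimod_hom M N] is
   Hom(M_B, N_B) with the (A, C)-bimodule structure (a f c)(m) = a f(c m). *)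
Section Hom.
Variables (A B C : pzRingType) (M : bimod C B) (N : bimod A B).
Local Notation H := (linhom (rmod M) (rmod N)).

Section Actions.
Variables (a : A) (f : H) (c : C).

Definition hom_lfun (m : rmod M) : rmod N := lact a (f m : N).
Fact hom_lfun_linear : linear hom_lfun.
Proof.
move=> b m m'; rewrite /hom_lfun linearP lactDr; congr (_ + _).
by rewrite /GRing.scale /= /rmod_scale lractA.
Qed.
HB.instance Definition _ := GRing.isLinear.Build B^c (rmod M) (rmod N) _
  hom_lfun hom_lfun_linear.
Definition hom_lact : H := hom_lfun.

Definition hom_rfun (m : rmod M) : rmod N := f (lact c (m : M)).
Fact hom_rfun_linear : linear hom_rfun.
Proof.
move=> b m m'; rewrite /hom_rfun lactDr /GRing.scale /= /rmod_scale -lractA.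
exact: (linearP f b).
Qed.
HB.instance Definition _ := GRing.isLinear.Build B^c (rmod M) (rmod N) _
  hom_rfun hom_rfun_linear.
Definition hom_ract : H := hom_rfun.

End Actions.

Program Definition bimod_hom : bimod A C :=
  @Bimod A C H hom_lact hom_ract _ _ _ _ _ _ _ _ _.
Next Obligation. by apply: linhomP => u; apply: lact1. Qed.
Next Obligation. by apply: linhomP => u; apply: lactA. Qed.
Next Obligation. by apply: linhomP => u; apply: lactDl. Qed.
Next Obligation. by apply: linhomP => u; apply: lactDr. Qed.
Next Obligation.
by apply: linhomP => u; rewrite /= /hom_rfun lact1.
Qed.
Next Obligation.
by apply: linhomP => u; rewrite /= /hom_rfun lactA.
Qed.
Next Obligation. by apply: linhomP. Qed.
Next Obligation.
by apply: linhomP => u; rewrite /= /hom_rfun lactDl; apply: raddfD.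
Qed.
Next Obligation. by apply: linhomP. Qed.

End Hom.

(* [M (x)_S N]: the free abelian group on [M * N] modulo the subgroup generated
   by the relations of biadditivity and S-balancedness. *)
Section Tensor.
Variables (A S B : pzRingType) (M : bimod A S) (N : bimod S B).
Local Notation K := (M * N)%type.
Local Notation F := {freeg K}.

Inductive tensor_rel : F -> Prop :=
| TensorRel0 : tensor_rel 0
| TensorRelB D D' : tensor_rel D -> tensor_rel D' -> tensor_rel (D - D')
| TensorRelDl m m' n : tensor_rel (<< (m + m', n) >> - << (m, n) >> - << (m', n) >>)
| TensorRelDr m n n' : tensor_rel (<< (m, n + n') >> - << (m, n) >> - << (m, n') >>)
| TensorRelA m s n : tensor_rel (<< (ract m s, n) >> - << (m, lact s n) >>).

Definition tensor_ker : {pred F} := [pred D | `[< tensor_rel D >]].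

Fact tensor_ker_zmod_closed : zmod_closed tensor_ker.
Proof.
split; first exact/asboolP/TensorRel0.
by move=> D D' /asboolP hD /asboolP hD'; apply/asboolP/TensorRelB.
Qed.
HB.instance Definition _ :=
  GRing.isZmodClosed.Build F tensor_ker tensor_ker_zmod_closed.

Definition tensor : zmodType := Quotient.quot tensor_ker.
Definition tens (m : M) (n : N) : tensor := \pi_tensor << (m, n) >>.

Lemma tens_pi (D D' : F) : tensor_rel (D - D') -> \pi_tensor D = \pi_tensor D'.
Proof. by move=> h; apply/eqP; rewrite -Quotient.idealrBE; apply/asboolP. Qed.

Lemma tens_piD D D' : \pi_tensor (D + D') = \pi_tensor D + \pi_tensor D'.
Proof. exact: (@Quotient.pi_add _ tensor_ker). Qed.
Lemma tens_piN D : \pi_tensor (- D) = - \pi_tensor D.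
Proof. exact: (@Quotient.pi_opp _ tensor_ker). Qed.
Lemma tens_piB D D' : \pi_tensor (D - D') = \pi_tensor D - \pi_tensor D'.
Proof. by rewrite tens_piD tens_piN. Qed.

Lemma tensDl m m' n : tens (m + m') n = tens m n + tens m' n.
Proof.
by rewrite /tens -tens_piD; apply: tens_pi; rewrite opprD addrA; apply: TensorRelDl.
Qed.
Lemma tensDr m n n' : tens m (n + n') = tens m n + tens m n'.
Proof.
by rewrite /tens -tens_piD; apply: tens_pi; rewrite opprD addrA; apply: TensorRelDr.
Qed.
Lemma tensA m s n : tens (ract m s) n = tens m (lact s n).
Proof. by apply: tens_pi; apply: TensorRelA. Qed.

Lemma tensor_ext (Z : zmodType) (f g : {additive tensor -> Z}) :
  (forall m n, f (tens m n) = g (tens m n)) -> f =1 g.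
Proof.
move=> fg; elim/quotW => D; rewrite -(freeg_sumE D).
rewrite !raddf_sum; apply: eq_bigr => -[m n] _.
rewrite -[coeff _ _]intz -freegU_mulz !raddfMz.
by congr (_ *~ _); apply: fg.
Qed.

Section Lift.
Variables (Z : zmodType) (b : M -> N -> Z).

Definition balanced := [/\ forall m m' n, b (m + m') n = b m n + b m' n,
  forall m n n', b m (n + n') = b m n + b m n'
  & forall m s n, b (ract m s) n = b m (lact s n)].

Definition tens_lift (t : tensor) : Z :=
  fglift (fun p : K => b p.1 p.2 : zmodule Z) (repr t).

Hypothesis bal : balanced.

Lemma tens_lift_pi D :
  tens_lift (\pi_tensor D) = fglift (fun p : K => b p.1 p.2 : zmodule Z) D.
Proof.
set l := fglift _.
have lB : {morph l : x y / x - y} by apply: lift_is_additive.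
have lU p : l << p >> = b p.1 p.2 by rewrite /l liftU scale1r.
have l0 : l 0 = 0 by rewrite -(subrr 0) lB subrr.
have lrel D' : tensor_rel D' -> l D' = 0.
  case: bal => bDl bDr bA; elim=> [|D1 D2 _ e1 _ e2|m m' n|m n n'|m s n] //.
  - by rewrite lB e1 e2 subrr.
  - by rewrite !lB !lU /= bDl addrAC addrK subrr.
  - by rewrite !lB !lU /= bDr addrAC addrK subrr.
  - by rewrite !lB !lU /= bA subrr.
have : repr (\pi_tensor D) - D \in tensor_ker.
  by rewrite Quotient.idealrBE reprK eqxx.
by move=> /asboolP/lrel/eqP; rewrite lB subr_eq0 => /eqP.
Qed.

Lemma tens_lift_additive : additive tens_lift.
Proof.
elim/quotW => D; elim/quotW => D'.
rewrite -tens_piB !tens_lift_pi.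
exact: (@lift_is_additive int _ (zmodule Z)).
Qed.

HB.instance Definition _ :=
  GRing.isZmodMorphism.Build tensor Z tens_lift tens_lift_additive.

Lemma tens_liftE m n : tens_lift (tens m n) = b m n.
Proof. by rewrite tens_lift_pi liftU scale1r. Qed.

End Lift.

End Tensor.

Section TensorBimodule.
Variables (A S B : pzRingType) (M : bimod A S) (N : bimod S B).

Definition tens_lact (a : A) : tensor M N -> tensor M N :=
  tens_lift (fun m n => tens (lact a m) n).
Definition tens_ract (b : B) : tensor M N -> tensor M N :=
  tens_lift (fun m n => tens m (ract n b)).

Fact tens_lact_balanced a : balanced (fun (m : M) (n : N) => tens (lact a m) n).
Proof.
split=> *; first by rewrite lactDr tensDl.
- exact: tensDr.
- by rewrite -lractA tensA.
Qed.
Fact tens_ract_balanced b : balanced (fun (m : M) (n : N) => tens m (ract n b)).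
Proof.
split=> *; first exact: tensDl.
- by rewrite ractDl tensDr.
- by rewrite tensA lractA.
Qed.

Lemma tens_lactE a m n : tens_lact a (tens m n) = tens (lact a m) n.
Proof. exact/tens_liftE/tens_lact_balanced. Qed.
Lemma tens_ractE m n b : tens_ract b (tens m n) = tens m (ract n b).
Proof. exact/tens_liftE/tens_ract_balanced. Qed.

HB.instance Definition _ a := GRing.isZmodMorphism.Build _ _ (tens_lact a)
  (tens_lift_additive (tens_lact_balanced a)).
HB.instance Definition _ b := GRing.isZmodMorphism.Build _ _ (tens_ract b)
  (tens_lift_additive (tens_ract_balanced b)).

Program Definition bimod_tensor : bimod A B :=
  @Bimod A B (tensor M N) tens_lact (fun t b => tens_ract b t) _ _ _ _ _ _ _ _ _.
Next Obligation.
apply: (tensor_ext (f := tens_lact 1) (g := idfun)) => m' n /=.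
by rewrite tens_lactE lact1.
Qed.
Next Obligation.
apply: (tensor_ext (f := tens_lact (a * a')) (g := tens_lact a \o tens_lact a')).
by move=> m' n /=; rewrite !tens_lactE lactA.
Qed.
Next Obligation.
apply: (tensor_ext (f := tens_lact (a + a')) (g := tens_lact a \+ tens_lact a')).
by move=> m' n /=; rewrite !tens_lactE lactDl tensDl.
Qed.
Next Obligation. exact: (raddfD (tens_lact a)). Qed.
Next Obligation.
apply: (tensor_ext (f := tens_ract 1) (g := idfun)) => m' n /=.
by rewrite tens_ractE ract1.
Qed.
Next Obligation.
apply: (tensor_ext (f := tens_ract (b * b'))
  (g := tens_ract b' \o tens_ract b)).
by move=> m' n /=; rewrite !tens_ractE ractA.
Qed.
Next Obligation. exact: (raddfD (tens_ract b)). Qed.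
Next Obligation.
apply: (tensor_ext (f := tens_ract (b + b'))
  (g := tens_ract b \+ tens_ract b')).
by move=> m' n /=; rewrite !tens_ractE ractDr tensDr.
Qed.
Next Obligation.
apply: (tensor_ext (f := tens_ract b \o tens_lact a)
  (g := tens_lact a \o tens_ract b)).
by move=> m' n /=; rewrite !(tens_lactE, tens_ractE).
Qed.

End TensorBimodule.

Section RingExtension.
Variables (R : pzRingType) (S : subringClosed R).

Definition subring := {r : R | r \in S}.
HB.instance Definition _ := [isSub of subring for sval].
HB.instance Definition _ := [Choice of subring by <:].
HB.instance Definition _ :=
  GRing.SubChoice_isSubPzRing.Build _ _ subring (GRing.subringClosedP S).

Definition bimod_RS : bimod R subring :=
  bimod_res idfun (val : subring -> R) (bimod_reg R).
Definition bimod_SR : bimod subring R :=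
  bimod_res (val : subring -> R) idfun (bimod_reg R).

Definition frobenius_extension : Prop :=
  [/\ finitely_generated (rmod bimod_RS), projective (rmod bimod_RS)
    & bimod_iso bimod_SR (bimod_hom bimod_RS (bimod_reg subring))].

Definition H_separable : Prop :=
  exists2 n, (0 < n)%N &
    iso_summand (bimod_tensor bimod_RS bimod_SR) (bimod_pow (bimod_reg R) n).

End RingExtension.

(* Main.v *)
Require Import Defs.
From mathcomp Require Import all_boot all_algebra.
From mathcomp Require Import boolp freeg.
Import GRing.Theory.
Local Open Scope ring_scope.
Local Open Scope quotient_scope.

(** Everything rests on two facts about the backward shift x: every vector is
    killed by some power of x, although xy = 1 makes every power of x right
    invertible.

    The element e = 1 - yx is the projection on the line k v_0.  As ey = 0 and
    xe = 0, it commutes with every element a + y r x of S; and since x kills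
    v_0, such an element acts on v_0 as the scalar a.

    R/S is not Frobenius because R is not finitely generated as a right
    S-module: if g_1, ..., g_n were generators, every r v_0 would be a
    k-combination of the vectors g_i v_0, and one power x^N kills all of these,
    but it does not kill y^N v_0.

    R/S is not H-separable: H-separability writes 1 (x) 1 as a combination
    sum z_i c_i where the Casimir elements c_i satisfy r c_i = c_i r for all r
    ([H_separable_casimir]).  As e commutes with S, there is a bimodule map
    r (x) s |-> r e s from R (x)_S R to R.  An element of its image has finite
    rank, hence is killed on the left by a power of x, while the image w of a
    Casimir element is central.  From x^N w = 0 and centrality,
    w = w x^N y^N = x^N w y^N = 0 ([nilpotent_central_eq0]).  So the
    map sends 1 (x) 1 to 0; but it sends 1 (x) 1 to e, which is not 0. *)

(** * Tensor products and H-separability *)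

(** A tensor is a sum of pure tensors and their opposites. *)
Lemma tensor_ind (A S B : pzRingType) (M : bimod A S) (N : bimod S B)
    (P : tensor M N -> Prop) :
  P 0 -> (forall t t', P t -> P t' -> P (t + t')) ->
  (forall t, P t -> P (- t)) -> (forall m n, P (tens m n)) -> forall t, P t.
Proof.
move=> P0 PD PN Pt; have PM t n : P t -> P (t *+ n).
  by move=> Pt'; elim: n => [|n IHn]; rewrite ?mulr0n // mulrS; apply: PD.
have pi_nat D n : \pi_(tensor M N) (D *+ n) = \pi_(tensor M N) D *+ n.
  elim: n => [|n IHn]; last by rewrite !mulrS tens_piD IHn.
  by rewrite !mulr0n -(subrr (0 : {freeg (M * N)})) tens_piB subrr.
elim/quotW => D; rewrite -(freeg_sumE D).
elim: (dom D) => [|[m n] s IHs]; first by rewrite big_nil (pi_nat 0 0).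
rewrite big_cons tens_piD; apply: PD => //.
rewrite -[coeff _ _]intz -freegU_mulz.
case: (coeff _ _) => i; rewrite ?NegzE ?mulrNz ?tens_piN -pmulrn pi_nat.
  exact/PM/Pt.
exact/PN/PM/Pt.
Qed.

(** If bimodule maps embed R (x)_S R into R^n and project R^n back onto it,
    take for z the image of 1 (x) 1 in R^n and for c_i the projection of the
    i-th unit vector.  A unit vector u of R^n satisfies r u = u r, and bimodule
    maps preserve this. *)
Lemma H_separable_casimir (R : pzRingType) (S : subringClosed R) :
  H_separable S ->
  exists n (z : 'I_n -> R)
      (c : 'I_n -> bimod_tensor (bimod_RS S) (bimod_SR S)),
    (forall i r, lact r (c i) = ract (c i) r) /\
    tens (1 : bimod_RS S) (1 : bimod_SR S) = \sum_i lact (z i) (c i).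
Proof.
move=> [n _ [Q [f [[g gK fK] fL fR]]]].
set T := bimod_tensor _ _ in Q f g gK fK fL fR *.
pose delta i : bimod_pow (bimod_reg R) n := [ffun j => (j == i)%:R].
have gL a u : g (lact a u) = lact a (g u).
  by rewrite -{1}(fK u) -fL gK.
have gR a u : g (ract u a) = ract (g u) a.
  by rewrite -{1}(fK u) -fR gK.
have gD u u' : g (u + u') = g u + g u'.
  by rewrite -{1}(fK u) -{1}(fK u') -raddfD gK.
have g0 : g 0 = 0 by rewrite -(raddf0 f) gK.
pose t1 : T := tens (1 : bimod_RS S) (1 : bimod_SR S).
exists n, (fun i => (f (t1, 0) : {ffun 'I_n -> R}) i), (fun i => (g (delta i)).1).
split=> [i r|].
  rewrite -[LHS]/((lact r (g (delta i))).1) -[RHS]/((ract (g (delta i)) r).1).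
  rewrite -gL -gR; congr (g _).1; apply/ffunP => j; rewrite !ffunE /=.
  by case: eqP => _; rewrite ?mulr0 ?mul0r ?mulr1 ?mul1r.
pose u := f (t1, 0); have t1E : t1 = (g u).1 by rewrite /u gK.
rewrite -[LHS]/t1 [LHS]t1E.
have uE : u = \sum_i lact ((u : {ffun 'I_n -> R}) i) (delta i).
  apply/ffunP => j; rewrite sum_ffunE (bigD1 j) //= big1 ?addr0.
    by rewrite !ffunE /= eqxx mulr1.
  by move=> i /negPf ij; rewrite !ffunE /= eq_sym ij mulr0.
rewrite [in LHS]uE (big_morph (fun w => (g w).1) (id1 := 0) (op1 := +%R)).
- by apply: eq_bigr => i _; rewrite gL.
- by move=> w w'; rewrite gD.
- by rewrite g0.
Qed.

(** * Shifts *)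

Lemma expr_right_inverse (R : pzRingType) (x y : R) (N : nat) :
  x * y = 1 -> x ^+ N * y ^+ N = 1.
Proof.
move=> xy1; elim: N => [|N IHN]; first by rewrite !expr0 mulr1.
by rewrite exprSr exprS mulrA -(mulrA _ x y) xy1 mulr1.
Qed.

Lemma nilpotent_central_eq0 (R : pzRingType) (x y w : R) (N : nat) :
  x * y = 1 -> (forall r, r * w = w * r) -> x ^+ N * w = 0 -> w = 0.
Proof.
move=> xy1 wC xw0.
by rewrite -[w]mulr1 -(expr_right_inverse _ _ _ N xy1) mulrA -wC xw0 mul0r.
Qed.

Lemma expr_mul_eq0W (R : pzRingType) (z r : R) (m n : nat) :
  (m <= n)%N -> z ^+ m * r = 0 -> z ^+ n * r = 0.
Proof. by move=> /subnK <- h; rewrite exprD -mulrA h mulr0. Qed.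

Section Shift.
Context {k : comNzRingType} {V : lmodType k} {v : nat -> V} {x y : lend V}.
Hypothesis v_basis : is_basis v.
Hypothesis xE : has_matrix v x (fun i j => (j == i.+1)%:R).
Hypothesis yE : has_matrix v y (fun i j => (i == j.+1)%:R).

Let R : pzRingType := lend V.
Let e : R := 1 - (y : R) * x.

Lemma basis0_neq0 : v 0%N <> 0.
Proof.
move=> v0; have [free _] := v_basis.
have := free 1%N (fun=> 1); rewrite big_ord1 scale1r => /(_ v0 ord0)/eqP.
by rewrite oner_eq0.
Qed.

Lemma sum_delta (n j : nat) : (j < n)%N ->
  \sum_(i < n) ((j == i)%:R : k) *: v i = v j.
Proof.
move=> jn; rewrite (bigD1 (Ordinal jn)) //= eqxx scale1r big1 ?addr0 //.
move=> i; rewrite -val_eqE /= eq_sym => /negPf ->; exact: scale0r.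
Qed.

Lemma shift_back0 : x (v 0%N) = 0.
Proof. by have [n [_ ->]] := xE 0%N; apply: big1 => i _; apply: scale0r. Qed.

Lemma shift_backS j : x (v j.+1) = v j.
Proof.
have [n [nE ->]] := xE j.+1; apply: sum_delta; rewrite ltnNge.
by apply/negP => /nE/eqP; rewrite eqxx oner_eq0.
Qed.

Lemma shift_forth j : y (v j) = v j.+1.
Proof.
have [n [nE ->]] := yE j; rewrite -(@sum_delta n j.+1).
  by apply: eq_bigr => i _; rewrite eq_sym.
by rewrite ltnNge; apply/negP => /nE/eqP; rewrite eqxx oner_eq0.
Qed.

Lemma shiftK : x * y = 1 :> R.
Proof.
apply: linhomP => u; have [n [c ->]] := v_basis.2 u.
rewrite !linear_sum; apply: eq_bigr => i _.
by rewrite !linearZ lendME shift_forth shift_backS lend1E.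
Qed.

Lemma shift_back_nilpotent u : exists N, ((x : R) ^+ N : lend V) u = 0.
Proof.
have [n [c ->]] := v_basis.2 u; exists n.
rewrite linear_sum big1 // => i _; rewrite linearZ /=.
suff -> : ((x : R) ^+ n : lend V) (v i) = 0 by rewrite scaler0.
elim: n {c u} i => [[]//|n IHn] [[|i] ilt] /=.
  by rewrite exprSr lendME shift_back0 linear0.
by rewrite exprSr lendME shift_backS (IHn (Ordinal (ilt : i < n)%N)).
Qed.

Lemma corner_proj0 : (e : lend V) (v 0%N) = v 0%N.
Proof. by rewrite -[LHS]/(v 0%N - y (x (v 0%N))) shift_back0 linear0 subr0. Qed.

Lemma corner_projS j : (e : lend V) (v j.+1) = 0.
Proof.
rewrite -[LHS]/(v j.+1 - y (x (v j.+1))).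
by rewrite shift_backS shift_forth subrr.
Qed.

Lemma corner_proj_range u : exists a : k, (e : lend V) u = a *: v 0%N.
Proof.
have [n [c ->]] := v_basis.2 u; case: n c => [|n] c.
  by exists 0; rewrite big_ord0 linear0 scale0r.
exists (c ord0); rewrite linear_sum big_ord_recl big1 => [|i _].
  by rewrite addr0 linearZ corner_proj0.
by rewrite linearZ /= [X in _ *: X](corner_projS i) scaler0.
Qed.

Lemma corner_proj_neq0 : e <> 0.
Proof. by move=> e0; apply: basis0_neq0; rewrite -corner_proj0 e0. Qed.

Lemma corner_proj_comm (a : k) (r : R) :
  e * (a *: (1 : lend V) + (y : R) * r * x) =
  (a *: (1 : lend V) + (y : R) * r * x : R) * e.
Proof.
have ey : e * y = 0 by rewrite mulrBl mul1r -mulrA shiftK mulr1 subrr.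
have xe : (x : R) * e = 0 by rewrite mulrBr mulr1 mulrA shiftK mul1r subrr.
rewrite [LHS]mulrDr [RHS]mulrDl !mulrA ey !mul0r -(mulrA _ _ e) xe mulr0; congr (_ + _).
by apply: linhomP => u; apply: (linearZ_LR (e : lend V) a u).
Qed.

(** The range of r e s lies in k (r v_0), so a power of x killing the single
    vector r v_0 suffices. *)
Lemma corner_ideal_nilpotent (r s : R) : exists N, (x : R) ^+ N * (r * e * s) = 0.
Proof.
have [N xN0] := shift_back_nilpotent ((r : lend V) (v 0%N)); exists N.
apply: linhomP => u; rewrite !lendME.
by have [a ->] := corner_proj_range ((s : lend V) u); rewrite !linearZ /= xN0 scaler0.
Qed.

Context {S : subringClosed (lend V)}.
Hypothesis SE : forall z : lend V, z \in S <->
  exists (a : k) (r : lend V), z = a *: (1 : lend V) + y * r * x.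

(** S-balancedness of (r, s) |-> r e s amounts to e commuting with S. *)
Lemma corner_balanced :
  balanced (fun (r : bimod_RS S) (s : bimod_SR S) => (r : R) * e * s : R).
Proof.
split=> [r r' s|r s s'|r [z zS] s] /=; first by rewrite !mulrDl.
  by rewrite mulrDr.
have [a [t ->]] := (SE z).1 zS.
by rewrite -(mulrA r) -corner_proj_comm !mulrA.
Qed.

(** If y^N is a combination of generators g_i with x^N g_i v_0 = 0, then
    v_0 = x^N y^N v_0 = 0. *)
Lemma not_finitely_generated : ~ finitely_generated (rmod (bimod_RS S)).
Proof.
move=> [n [g gen]].
(* A common exponent for the finitely many vectors g_i v_0. *)
have [N gN] : exists N, forall i, ((x : R) ^+ N : lend V) ((g i : lend V) (v 0%N)) = 0.
  have [F FE] := choice (fun i => shift_back_nilpotent ((g i : lend V) (v 0%N))).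
  exists (\max_i F i)%N => i; rewrite -(subnK (leq_bigmax i)) exprD lendME FE.
  exact: linear0.
have [c yN] := gen ((y : R) ^+ N).
apply: basis0_neq0; rewrite -[LHS](lend1E (v 0%N)).
rewrite -(expr_right_inverse _ _ _ N shiftK) lendME yN.
elim/big_rec: _ => [|i w _ IHw]; first by rewrite linear0.
have -> : (c i *: g i + w : rmod _) = (g i : R) * (val (c i) : R) + w :> R by [].
rewrite lendDE linearD IHw addr0 lendME.
have [a [t ->]] := (SE _).1 (valP (c i)).
rewrite lendDE lendZE lend1E !lendME shift_back0 !linear0 addr0.
by rewrite !linearZ /= gN scaler0.
Qed.

(** phi : r (x) s |-> r e s kills Casimir elements, although it sends 1 (x) 1
    to e. *)
Lemma not_H_separable : ~ H_separable S.
Proof.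
move=> /H_separable_casimir[n [z [c [cC one]]]].
pose phi := tens_lift (fun (r : bimod_RS S) (s : bimod_SR S) => (r : R) * e * s : R).
have bal := corner_balanced.
pose T := bimod_tensor (bimod_RS S) (bimod_SR S).
have phiE r s : phi (tens r s) = (r : R) * e * s by rewrite /phi tens_liftE.
have phiB : {morph phi : t t' / t - t'} by apply: tens_lift_additive.
have phi0 : phi 0 = 0 by rewrite -(subrr 0) phiB subrr.
have phiN : {morph phi : t / - t} by move=> t; rewrite -sub0r phiB phi0 sub0r.
have phiD : {morph phi : t t' / t + t'}.
  by move=> t t'; rewrite -{1}(opprK t') phiB phiN opprK.
have phiL r (t : T) : phi (lact r t) = r * phi t.
  elim/(@tensor_ind _ _ _ (bimod_RS S) (bimod_SR S)): t => [|t t' IH IH'|t IH|m s].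
  - by rewrite /= raddf0 phi0 mulr0.
  - by rewrite lactDr !phiD IH IH' mulrDr.
  - by rewrite /= raddfN !phiN IH mulrN.
  - by rewrite /= tens_lactE !phiE /= !mulrA.
have phiR r (t : T) : phi (ract t r) = phi t * r.
  elim/(@tensor_ind _ _ _ (bimod_RS S) (bimod_SR S)): t => [|t t' IH IH'|t IH|m s].
  - by rewrite /= raddf0 phi0 mul0r.
  - by rewrite ractDl !phiD IH IH' mulrDl.
  - by rewrite /= raddfN !phiN IH mulNr.
  - by rewrite /= tens_ractE !phiE /= !mulrA.
have phi_nil t : exists N, (x : R) ^+ N * phi t = 0.
  elim/(@tensor_ind _ _ _ (bimod_RS S) (bimod_SR S)): t
    => [|t t' [N h] [N' h']|t [N h]|m s].
  - by exists 0%N; rewrite phi0 mulr0.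
  - exists (maxn N N'); rewrite phiD mulrDr.
    rewrite (expr_mul_eq0W _ _ _ _ _ (leq_maxl _ _) h).
    by rewrite (expr_mul_eq0W _ _ _ _ _ (leq_maxr _ _) h') addr0.
  - by exists N; rewrite phiN mulrN h oppr0.
  - by rewrite phiE; apply: corner_ideal_nilpotent.
apply: corner_proj_neq0; rewrite -[e]mulr1 -[e]mul1r -phiE one.
elim/big_rec: _ => // i t _ IHt; rewrite phiD IHt addr0 phiL.
have [N xN] := phi_nil (c i).
rewrite (nilpotent_central_eq0 _ _ _ _ _ shiftK _ xN) ?mulr0 // => r.
by rewrite -phiL -phiR cC.
Qed.

End Shift.

Theorem corollary4p3 (k : comNzRingType) (V : lmodType k) (v : nat -> V)
    (v_basis : is_basis v) (x y : lend V)
    (xE : has_matrix v x (fun i j => (j == i.+1)%:R))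
    (yE : has_matrix v y (fun i j => (i == j.+1)%:R))
    (S : subringClosed (lend V))
    (SE : forall z : lend V, z \in S <->
      exists (a : k) (r : lend V), z = a *: (1 : lend V) + y * r * x) :
  ~ frobenius_extension S /\ ~ H_separable S.
Proof.
split; last exact: (not_H_separable v_basis xE yE SE).
by move=> [fg _ _]; apply: (not_finitely_generated v_basis xE yE SE).
Qed.
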